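(* Let $U,V\subset\mathbb{R}^n$ be linear subspaces with $1\le \dim U\le \dim V\le n-1$, $U\neq U\cap V$ and $U\cap V\neq\{0\}$. Given $z\in\mathbb{R}^n$, set $x_0=0$ and consider the AAMR sequence $\{x_k\}_{k=0}^\infty$ generated by $$x_{k+1}:=(1-\alpha)x_k+\alpha(2\beta P_{V-z}-I)(2\beta P_{U-z}-I)(x_k),\quad k=0,1,2,\ldots,$$ with parameters $\alpha\in\,]0,1]$ and $\beta\in\,]0,1[$. Let $\{z_k\}_{k=0}^\infty$ be the sequence generated by the generalized alternating projections (GAP) scheme $$z_{k+1}=(1-\alpha)z_k+\alpha\left(\alpha_1P_V+(1-\alpha_1)I\right)\left(\alpha_2P_U+(1-\alpha_2)I\right)(z_k),\quad k=0,1,2,\ldots,$$ with the same parameter $\alpha$, with $\alpha_1=\alpha_2=2\beta$, and with starting point $z_0=z$. Then, one has $$P_U(x_k+z)=P_U(z_k)\quad\text{and}\quad P_V(x_k)=(2\beta-1)P_V(z_k-z),$$ for all $k=0,1,2,\ldots$.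
   Context: The setting is $\mathbb{R}^n$ with the Euclidean inner product and norm. $P_C$ denotes the projector onto a nonempty closed convex set $C$, $I$ is the identity, and $U-z:=\{u-z : u\in U\}$. Products of operators denote composition. AAMR stands for averaged alternating modified reflections. *)

(* Defs.v *)
From mathcomp Require Export all_boot all_order all_algebra.
From mathcomp Require Export boolp classical_sets reals.

Set Implicit Arguments.
Unset Strict Implicit.
Unset Printing Implicit Defensive.

Import Order.TTheory GRing.Theory Num.Theory.
Local Open Scope classical_set_scope.
Local Open Scope ring_scope.

Section Euclidean.
Context {R : realType} {n : nat}.
Implicit Types (x y z p : 'rV[R]_n) (C : set 'rV[R]_n).

Definition inner x y : R := \sum_(i < n) x 0 i * y 0 i.

(* The norm `|x| that MathComp-Analysis puts on 'rV[R]_n is the sup norm. *)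
Definition enorm x : R := Num.sqrt (inner x x).

Definition is_proj C x p : Prop :=
  C p /\ forall q, C q -> enorm (x - p) <= enorm (x - q).

(* P_C.  For C nonempty, closed and convex the nearest point exists and is
   unique; the default value x of xget is used only when there is none. *)
Definition proj C x : 'rV[R]_n := xget x [set p | is_proj C x p].

Definition translate C z : set 'rV[R]_n := [set u - z | u in C].

Definition modified_reflector (b : R) C x : 'rV[R]_n := (2 * b) *: proj C x - x.

Definition relaxed_proj (a : R) C x : 'rV[R]_n := a *: proj C x + (1 - a) *: x.

End Euclidean.

(* Main.v *)
From HB Require Import structures.
Require Import Defs.
From mathcomp Require Import all_boot all_order all_algebra.
From mathcomp Require Import boolp classical_sets reals.
From mathcomp Require Import ring.

Import Order.TTheory GRing.Theory Num.Theory.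
Local Open Scope classical_set_scope.
Local Open Scope ring_scope.

(** Write P and Q for the projectors onto U and V, and c for 2 beta. Both are
linear and idempotent, and projecting onto U - z is P (x + z) - z, so each
iteration is an explicit affine combination of P, Q and the identity. The claim
is proved by induction on k, in the translated form
P x_k = P (z_k - z) and Q x_k = (c - 1) Q (z_k - z).

Let y and w be the results of the first and the second modified reflection of
x_k, and r and t those of the first and the second relaxed projection of z_k.
The two schemes then use the same projections: P (x_k + z) = P z_k by the first
identity, and together with the second it gives Q (y + z) = Q r. Moreover a
relaxed projection leaves the projection onto its own subspace unchanged
(P r = P z_k, Q t = Q r), while a modified reflection multiplies it by c - 1
(P y = (c - 1) P x_k, Q w = (c - 1) Q y). Expanding P w and Q w by linearity
then gives the same two identities for the pair (w, t) (aamr_gap_step), and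
averaging with the previous iterates preserves them, since they are linear in
the pair (x_k, z_k - z) (proj_relax).

Projectors being nearest points, their linearity is obtained by characterizing
the nearest point of a subspace as the foot of the perpendicular. That foot
exists by Gram-Schmidt (orthogonal_proj_exists) and is the unique nearest point
by Pythagoras (orthogonal_is_proj). *)

Section Inner.
Local Set Implicit Arguments.
Local Unset Strict Implicit.
Variables (R : realType) (n : nat).
Implicit Types x y w : 'rV[R]_n.

Lemma innerC x y : inner x y = inner y x.
Proof. by apply: eq_bigr => i _; rewrite mulrC. Qed.

Lemma inner_is_linear x : scalar (inner x).
Proof.
move=> a y w; rewrite /inner mulr_sumr -big_split /=.
by apply: eq_bigr => i _; rewrite !mxE; ring.
Qed.

HB.instance Definition _ x :=
  GRing.isLinear.Build R 'rV[R]_n R _ (inner x) (inner_is_linear x).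

Lemma inner_ge0 x : 0 <= inner x x.
Proof. by apply: sumr_ge0 => i _; rewrite -expr2 sqr_ge0. Qed.

Lemma inner_eq0 x : (inner x x == 0) = (x == 0).
Proof.
apply/idP/eqP => [|->]; last by rewrite linear0.
rewrite psumr_eq0 => [/allP x0|i _]; last by rewrite -expr2 sqr_ge0.
apply/rowP => i; rewrite mxE; apply/eqP; rewrite -sqrf_eq0 expr2.
by have := x0 i; rewrite mem_index_enum; apply.
Qed.

Lemma ler_enorm x y : (enorm x <= enorm y) = (inner x x <= inner y y).
Proof. by rewrite ler_sqrt // inner_ge0. Qed.

Lemma pythagoras x y : inner x y = 0 ->
  inner (x + y) (x + y) = inner x x + inner y y.
Proof.
move=> xy0; rewrite linearD /= (innerC _ x) (innerC _ y) !linearD /=.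
by rewrite (innerC y x) xy0 addr0 add0r.
Qed.

End Inner.

Section SubspaceProjector.
Local Set Implicit Arguments.
Local Unset Strict Implicit.
Variables (R : realType) (n : nat).
Implicit Types (U : {vspace 'rV[R]_n}) (x y z p : 'rV[R]_n).

Definition orthogonal_proj U x p :=
  p \in U /\ forall q, q \in U -> inner q (x - p) = 0.

(** One Gram-Schmidt step per vector of a spanning sequence: the new vector v is
replaced by its component w orthogonal to the previous ones, and the component
of x along w is added to the projection on their span. *)
Lemma orthogonal_proj_exists U x : exists p, orthogonal_proj U x p.
Proof.
rewrite -(span_basis (vbasisP U)); move: (tval (vbasis U)) x => X.
elim: X => [|v X IH] x.
  exists 0; split=> [|q]; first exact: mem0v.
  by rewrite span_nil memv0 => /eqP->; rewrite innerC linear0.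
have [p [pX xpX]] := IH x; have [v' [v'X vv'X]] := IH v.
set w := v - v' in vv'X; pose t := inner w (x - p) / inner w w.
have w_in : w \in <<v :: X>>%VS.
  rewrite span_cons rpredB //.
    by apply: (subvP (addvSl _ _)); apply: memv_line.
  by apply: (subvP (addvSr _ _)).
exists (p + t *: w); split.
  apply: rpredD; last exact: rpredZ.
  by rewrite span_cons; apply: (subvP (addvSr _ _)).
have resX q : q \in <<X>>%VS -> inner q (x - (p + t *: w)) = 0.
  by move=> qX; rewrite opprD addrA linearB linearZ /= xpX // vv'X // mulr0 subr0.
have resw : inner w (x - (p + t *: w)) = 0.
  rewrite opprD addrA linearB linearZ /= /t.
  (* If w = 0, both terms vanish whatever the value of t. *)
  have [->|w0] := eqVneq w 0; first by rewrite !(innerC 0) !linear0 mulr0 subr0.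
  by rewrite divfK ?subrr // inner_eq0.
move=> q; rewrite span_cons => /memv_addP[_ /vlineP[a ->] [u uX ->]].
(* v = w + v', and the residual is orthogonal to both w and v'. *)
rewrite innerC linearD linearZ /= -(subrK v' v) linearD /=.
by rewrite !(innerC (x - _)) resw !resX // !(addr0, mulr0).
Qed.

Lemma orthogonal_proj_dist U x p q : orthogonal_proj U x p -> q \in U ->
  inner (x - q) (x - q) = inner (x - p) (x - p) + inner (p - q) (p - q).
Proof.
move=> [pU xpU] qU; rewrite -pythagoras; first by rewrite subrKA.
by rewrite innerC xpU // rpredB.
Qed.

(** By Pythagoras, the squared distance from x to a point q of U exceeds the one
to p by the squared norm of p - q; hence p is a nearest point, and a nearest q must satisfy p = q. *)
Lemma orthogonal_is_proj U x p q : orthogonal_proj U x p ->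
  is_proj [set` U] x q <-> q = p.
Proof.
move=> xp; have [pU _] := xp; split=> [[qU /(_ p pU)]|->].
  rewrite ler_enorm (orthogonal_proj_dist xp) // gerDl => pq.
  apply/esym/eqP; rewrite -subr_eq0 -inner_eq0.
  by rewrite eq_le pq inner_ge0.
split=> // r rU.
by rewrite ler_enorm (orthogonal_proj_dist xp rU) lerDl inner_ge0.
Qed.

(** Translation by z carries the nearest-point problem for U - z at x to the one
for U at x + z. *)
Lemma proj_translate_orthogonal U z x p : orthogonal_proj U (x + z) p ->
  proj (translate [set` U] z) x = p - z.
Proof.
move=> xp.
have translateP q : is_proj (translate [set` U] z) x q <->
    is_proj [set` U] (x + z) (q + z).
  split=> [[[u uU <-] minq]|[qU minq]].
    rewrite subrK; split=> // r rU.
    by have := minq (r - z) (ex_intro2 _ _ r rU erefl); rewrite !opprB !addrA.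
  split; first by exists (q + z); rewrite // addrK.
  move=> _ [r rU <-]; have := minq r rU.
  by rewrite opprD opprB !addrA addrAC addrK.
apply: xget_unique => [|q /translateP /(orthogonal_is_proj _ xp) <-].
  by apply/translateP; rewrite subrK; apply/(orthogonal_is_proj _ xp).
by rewrite addrK.
Qed.

Lemma proj_orthogonal U x p : orthogonal_proj U x p -> proj [set` U] x = p.
Proof.
move=> xp; apply: xget_unique => [|q]; last by move/(orthogonal_is_proj _ xp).
exact/(orthogonal_is_proj _ xp).
Qed.

Lemma projP U x : orthogonal_proj U x (proj [set` U] x).
Proof.
by have [p xp] := orthogonal_proj_exists U x; rewrite (proj_orthogonal xp).
Qed.

Lemma proj_translate U z x :
  proj (translate [set` U] z) x = proj [set` U] (x + z) - z.
Proof. exact/proj_translate_orthogonal/projP. Qed.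

Lemma proj_is_linear U : linear (proj [set` U]).
Proof.
move=> a x y; have [px ox] := projP U x; have [py oy] := projP U y.
apply: proj_orthogonal; split=> [|q qU]; first by rewrite rpredD ?rpredZ.
by rewrite opprD addrACA -scalerBr linearD linearZ /= ox // oy // mulr0 addr0.
Qed.

Lemma projD U : {morph proj [set` U] : x y / x + y}.
Proof. by move=> x y; have:= proj_is_linear U 1 x y; rewrite !scale1r. Qed.

Lemma proj0 U : proj [set` U] 0 = 0.
Proof. by apply: (addrI (proj [set` U] 0)); rewrite -projD !addr0. Qed.

Lemma projZ U a x : proj [set` U] (a *: x) = a *: proj [set` U] x.
Proof. by have:= proj_is_linear U a x 0; rewrite proj0 !addr0. Qed.

Lemma projB U : {morph proj [set` U] : x y / x - y}.
Proof. by move=> x y; rewrite -scaleN1r projD projZ scaleN1r. Qed.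

Lemma proj_idem U x : proj [set` U] (proj [set` U] x) = proj [set` U] x.
Proof.
apply: proj_orthogonal; split=> [|q _]; first by have [] := projP U x.
by rewrite subrr linear0.
Qed.

End SubspaceProjector.

Section Step.
Local Set Implicit Arguments.
Local Unset Strict Implicit.
Variables (R : realType) (n : nat) (U V : {vspace 'rV[R]_n}).

Local Notation P := (proj [set` U]).
Local Notation Q := (proj [set` V]).

(** The scalar m is 1 for U and 2 beta - 1 for V. *)
Lemma proj_relax (W : {vspace 'rV[R]_n}) (m a : R) (z x w s t : 'rV[R]_n) :
  proj [set` W] x = m *: proj [set` W] (s - z) ->
  proj [set` W] w = m *: proj [set` W] (t - z) ->
  proj [set` W] ((1 - a) *: x + a *: w) =
    m *: proj [set` W] ((1 - a) *: s + a *: t - z).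
Proof.
move=> Wx Ww; have -> : (1 - a) *: s + a *: t - z =
    (1 - a) *: (s - z) + a *: (t - z) by apply/rowP => i; rewrite !mxE; ring.
rewrite [LHS]projD [in RHS]projD !projZ Wx Ww scalerDr !scalerA.
by rewrite !(mulrC m).
Qed.

(** The pair (w, t) satisfies the same relations as (x, s). They are not
independent: the one for V at (x, s) is what identifies Q (y + z) with Q r, a
value on which both P w and P t depend. *)
Lemma aamr_gap_step (c : R) (z x s : 'rV[R]_n) :
  P x = P (s - z) -> Q x = (c - 1) *: Q (s - z) ->
  let y := c *: (P (x + z) - z) - x in
  let w := c *: (Q (y + z) - z) - y in
  let r := c *: P s + (1 - c) *: s in
  let t := c *: Q r + (1 - c) *: r in
  P w = P (t - z) /\ Q w = (c - 1) *: Q (t - z).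
Proof.
move=> Px Qx y w r t.
have Pxz : P (x + z) = P s by rewrite projD Px projB subrK.
have Qyz : Q (y + z) = Q r.
  rewrite /y Pxz /r !(projB, projD, projZ) Qx projB.
  by apply/rowP => i; rewrite !mxE; ring.
have Pr : P r = P s.
  by rewrite projD !projZ proj_idem -scalerDl addrCA subrr addr0 scale1r.
(* From here on only P r matters; an opaque r keeps the rewriting by linearity
   from expanding it again. *)
clearbody r.
have Qt : Q t = Q r.
  by rewrite projD !projZ proj_idem -scalerDl addrCA subrr addr0 scale1r.
split.
  rewrite /w Qyz /y Pxz /t !(projB, projD, projZ) proj_idem.
  rewrite Pr Px projB.
  by apply/rowP => i; rewrite !mxE; ring.
have Qy : Q y = Q r - Q z by rewrite -Qyz [Q (y + z)]projD addrK.
clearbody y.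
rewrite [Q (t - z)]projB Qt /w Qyz !(projB, projD, projZ) proj_idem Qy.
by apply/rowP => i; rewrite !mxE; ring.
Qed.

End Step.

Theorem theorem4p1 (R : realType) (n : nat) (U V : {vspace 'rV[R]_n})
    (dimU_ge1 : (1 <= \dim U)%N)
    (dimU_le_dimV : (\dim U <= \dim V)%N)
    (dimV_le : (\dim V <= n - 1)%N)
    (U_neq : U <> (U :&: V)%VS)
    (UV_neq0 : (U :&: V)%VS <> 0%VS)
    (z : 'rV[R]_n) (alpha beta : R)
    (alpha_gt0 : 0 < alpha) (alpha_le1 : alpha <= 1)
    (beta_gt0 : 0 < beta) (beta_lt1 : beta < 1)
    (x_ : nat -> 'rV[R]_n)
    (x_0 : x_ 0%N = 0)
    (x_S : forall k : nat,
       x_ k.+1 = (1 - alpha) *: x_ k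
         + alpha *: (modified_reflector beta (translate [set` V] z)
                     \o modified_reflector beta (translate [set` U] z)) (x_ k))
    (alpha1 alpha2 : R)
    (alpha1E : alpha1 = 2 * beta) (alpha2E : alpha2 = 2 * beta)
    (z_ : nat -> 'rV[R]_n)
    (z_0 : z_ 0%N = z)
    (z_S : forall k : nat,
       z_ k.+1 = (1 - alpha) *: z_ k
         + alpha *: (relaxed_proj alpha1 [set` V]
                     \o relaxed_proj alpha2 [set` U]) (z_ k)) :
  forall k : nat,
    proj [set` U] (x_ k + z) = proj [set` U] (z_ k) /\
    proj [set` V] (x_ k) = (2 * beta - 1) *: proj [set` V] (z_ k - z).
Proof.
(* Subtracting z makes the relation for U linear in the pair (x, z_k - z). *)
suff invariant k : proj [set` U] (x_ k) = proj [set` U] (z_ k - z) /\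
    proj [set` V] (x_ k) = (2 * beta - 1) *: proj [set` V] (z_ k - z).
  move=> k; have [Ux Vx] := invariant k; split=> //.
  by rewrite projD Ux projB subrK.
elim: k => [|k [Ux Vx]]; first by rewrite x_0 z_0 subrr !proj0 scaler0.
have [Uw Vw] := aamr_gap_step Ux Vx.
rewrite x_S z_S /= /modified_reflector /relaxed_proj !proj_translate.
rewrite alpha1E alpha2E.
split; last exact: proj_relax Vx Vw.
by rewrite -[RHS]scale1r; apply: proj_relax; rewrite scale1r.
Qed.
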